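(* There is an absolute constant $c>0$ such that the following holds. For every $n \in \mathbb{N}$, every matroid $\mathcal{M} \subseteq 2^{[n]}$ and every positive integer $k$, there is an online algorithm for the secretary problem with feasibility constraint $\mathcal{M}^k$ that is $\bigl(1-c\sqrt{\log(n)/k}\bigr)$-competitive.
   Context: Matroids are identified with their families of independent sets: a matroid on $N=[n]$ is a family $\mathcal{M}\subseteq 2^N$ containing $\emptyset$, closed downward, and satisfying augmentation (if $S,T\in\mathcal{M}$ and $|S|<|T|$, there is $i\in T\setminus S$ with $S\cup\{i\}\in\mathcal{M}$). For matroids $\mathcal{M}_1,\dots,\mathcal{M}_k$ on $N$, the union $\mathcal{M}_1\lor\dots\lor\mathcal{M}_k$ is the matroid consisting of all $S$ that can be partitioned into $S_1,\dots,S_k$ with $S_\ell\in\mathcal{M}_\ell$ for all $\ell$. The $k$-fold union is $\mathcal{M}^k=\bigvee_{i\in[k]}\mathcal{M}$. Secretary problem with feasibility constraint $\mathcal{F}\subseteq 2^N$: the elements of $N=[n]$ have distinct nonnegative weights, unknown in advance, while $\mathcal{F}$ is known in advance. The elements arrive one at a time in uniformly random order. When element $i$ arrives its weight is revealed, and the algorithm must irrevocably accept or reject it, and may accept it only if $\mathrm{ALG}\cup\{i\}\in\mathcal{F}$, where $\mathrm{ALG}$ is the set accepted so far. For $S\subseteq N$, $w(S)$ is the sum of the weights of its elements. An algorithm is $\alpha$-competitive if, for every weight assignment, $\mathbb{E}[w(\mathrm{ALG})]\ge \alpha\cdot\max_{S\in\mathcal{F}}w(S)$, where the expectation is over the random arrival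 order and the algorithm's internal randomness. *)

(* Defs.v *)
From HB Require Import structures.
From mathcomp Require Import all_boot all_order all_algebra.
From mathcomp Require Import fingroup perm reals exp.
Set Implicit Arguments. Unset Strict Implicit. Unset Printing Implicit Defensive.
Import Order.TTheory GRing.Theory Num.Theory.
Local Open Scope ring_scope.

Definition is_matroid (n : nat) (M : {set {set 'I_n}}) : Prop :=
  [/\ set0 \in M,
      (forall S T : {set 'I_n}, S \in M -> T \subset S -> T \in M) &
      (forall S T : {set 'I_n}, S \in M -> T \in M -> (#|S| < #|T|)%N ->
         exists2 i, i \in T :\: S & S :|: [set i] \in M)].

(* k-fold union M^k: all S that can be partitioned into S_1,...,S_k with
   every S_l in M (the partition is encoded by a labelling f : S -> [k]). *)
Definition kfold_union (n k : nat) (M : {set {set 'I_n}}) : {set {set 'I_n}} :=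
  [set S : {set 'I_n} | [exists f : {ffun 'I_n -> 'I_k},
      [forall l : 'I_k, [set i in S | f i == l] \in M]]].

(* An online (randomized) algorithm, given as a behavioural strategy:
   given the history so far (the elements that arrived, in order, with their
   revealed weights and the algorithm's accept/reject decisions), and the
   currently arriving element together with its weight, it returns the
   probability with which it accepts the current element. *)
Definition history (n : nat) (R : Type) := seq ('I_n * R * bool).
Definition online_alg (n : nat) (R : Type) := history n R -> 'I_n -> R -> R.

Definition accepted (n : nat) (R : eqType) (h : history n R) : {set 'I_n} :=
  [set j | has (fun e : 'I_n * R * bool => (e.1.1 == j) && e.2) h].

Definition valid_alg (n : nat) (R : realType) (F : {set {set 'I_n}})
    (alg : online_alg n R) : Prop :=
  forall (h : history n R) (i : 'I_n) (x : R),
    0 <= alg h i x <= 1 /\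
    (accepted h :|: [set i] \notin F -> alg h i x = 0).

Fixpoint exp_gain (n : nat) (R : realType) (alg : online_alg n R)
    (w : 'I_n -> R) (h : history n R) (order : seq 'I_n) : R :=
  match order with
  | [::] => 0
  | i :: rest =>
      let p := alg h i (w i) in
      p * (w i + exp_gain alg w (rcons h (i, w i, true)) rest)
      + (1 - p) * exp_gain alg w (rcons h (i, w i, false)) rest
  end.

(* E[w(ALG)] over a uniformly random arrival order (element s t arrives at
   time t) and the algorithm's internal randomness. *)
Definition expected_value (n : nat) (R : realType) (alg : online_alg n R)
    (w : 'I_n -> R) : R :=
  (n`!%:R)^-1 * \sum_(s : {perm 'I_n}) exp_gain alg w [::] [seq s t | t <- enum 'I_n].

(* max_{S in F} w(S) (weights are nonnegative and F contains set0 in our use). *)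
Definition opt (n : nat) (R : realType) (F : {set {set 'I_n}}) (w : 'I_n -> R) : R :=
  \big[Num.max/0]_(S in F) (\sum_(i in S) w i).

(* Main.v *)
(* When t elements A have arrived, select the last one if it belongs to a
   heaviest set of M^(k_t) inside A, where k_t is about (1 - eps) k t / n and
   eps is of order sqrt(ln n / k), and accept it if this keeps feasibility.

   By the matroid union theorem, S is in M^k iff |S & cl I| <= k |I| for all
   independent I. Reading the arrival order backwards, the t-th arrival is
   uniform among the first t, so it is selected inside cl I with probability at
   most k_t |I| / t <= (1 - eps) k |I| / n, independently of the future. A
   Chernoff bound shows that the constraint of I fails with probability at most
   n^(-4 |I|), and the union bound over all nonempty I costs (1 + n^-4)^n - 1.
   The same bound, for sampling without replacement, shows that the part of the
   optimum in the first t arrivals nearly fits into M^(k_t): the expected gain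
   at time t is at least (1 - O(sqrt(ln n / k) sqrt(n / t))) OPT / n, and
   the sum over t of sqrt(n / t) is at most 2 n. *)
Require Import Defs.
From HB Require Import structures.
From mathcomp Require Import all_boot all_order all_algebra.
From mathcomp Require Import fingroup perm reals exp.
From mathcomp Require Import sequences zify ring lra.
Import Order.TTheory GRing.Theory Num.Theory.
Local Open Scope ring_scope.

Set Implicit Arguments.
Unset Strict Implicit.
Unset Printing Implicit Defensive.

(** * The matroid union theorem *)

Section Rado.

Variables (I E : finType) (rho : {set E} -> nat).
Hypothesis rho0 : rho set0 = 0%N.
Hypothesis rhoS : forall A B : {set E}, A \subset B -> (rho A <= rho B)%N.
Hypothesis rho_submod :
  forall A B : {set E}, (rho (A :|: B) + rho (A :&: B) <= rho A + rho B)%N.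

(** Rado's condition for an independent transversal of the lists [A i], [i] in [S], in the matroid
    with rank function [rho]. *)
Definition hall_rank (S : {set I}) (A : {ffun I -> {set E}}) : bool :=
  [forall J : {set I}, (J \subset S) ==> (#|J| <= rho (\bigcup_(j in J) A j))%N].

Definition shrink (A : {ffun I -> {set E}}) (i : I) (x : E) :
  {ffun I -> {set E}} := [ffun j => if j == i then A i :\ x else A j].

Lemma bigcup_shrink (A : {ffun I -> {set E}}) (i : I) (x : E) (J : {set I}) :
  i \in J ->
  \bigcup_(j in J) shrink A i x j = (A i :\ x) :|: \bigcup_(j in J :\ i) A j.
Proof.
move=> iJ; rewrite (big_setD1 i) //= ffunE eqxx; congr (_ :|: _).
by apply: eq_bigr => j /setD1P[/negPf ji _]; rewrite ffunE ji.
Qed.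

Lemma shrink_violator (S : {set I}) (A : {ffun I -> {set E}}) (i : I) (x : E) :
  hall_rank S A -> ~~ hall_rank S (shrink A i x) ->
  exists J : {set I}, [/\ J \subset S, i \in J &
    (rho ((A i :\ x) :|: \bigcup_(j in J :\ i) A j) < #|J|)%N].
Proof.
move=> /forallP hA /forallPn[J]; rewrite negb_imply -ltnNge => /andP[JS lt].
exists J; suff iJ : i \in J by rewrite -bigcup_shrink.
apply: contraLR lt => iJ; rewrite -leqNgt.
have -> : \bigcup_(j in J) shrink A i x j = \bigcup_(j in J) A j.
  apply: eq_bigr => j jJ; rewrite ffunE; case: eqP => // ji.
  by rewrite -ji jJ in iJ.
by move: (hA J); rewrite JS.
Qed.

(* Rado: if deleting x from A i violates the condition at J1 and deleting y
   violates it at J2, then submodularity violates it at J1 :|: J2 or at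
   (J1 :&: J2) :\ i; hence a minimal family consists of singletons. *)
Lemma hall_rank_shrink (S : {set I}) (A : {ffun I -> {set E}}) (i : I)
    (x y : E) : hall_rank S A -> x != y -> x \in A i -> y \in A i ->
  hall_rank S (shrink A i x) || hall_rank S (shrink A i y).
Proof.
move=> hA xy xA yA; apply/negPn/negP; rewrite negb_or => /andP[].
move=> /(shrink_violator hA)[J1 [J1S iJ1 lt1]].
move=> /(shrink_violator hA)[J2 [J2S iJ2 lt2]].
set U1 := _ :|: _ in lt1; set U2 := _ :|: _ in lt2.
have cupJ : \bigcup_(j in J1 :|: J2) A j \subset U1 :|: U2.
  apply/bigcupsP => j jJ; case: (eqVneq j i) => [->|ji].
    apply/subsetP => z zA; rewrite !inE zA.
    by case: (eqVneq z x) => [->|]; rewrite ?xy ?orbT.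
  have: (j \in J1 :\ i) || (j \in J2 :\ i) by rewrite !inE ji -in_setU.
  case/orP => jJi; apply/subsetP => z zA; rewrite !inE.
    have -> : z \in \bigcup_(j in J1 :\ i) A j by apply/bigcupP; exists j.
    by rewrite orbT.
  have -> : z \in \bigcup_(j in J2 :\ i) A j by apply/bigcupP; exists j.
  by rewrite !orbT.
have capJ : \bigcup_(j in (J1 :&: J2) :\ i) A j \subset U1 :&: U2.
  apply/bigcupsP => j; rewrite !inE => /and3P[ji j1 j2].
  apply/subsetP => z zA; rewrite !inE.
  have -> : z \in \bigcup_(j in J1 :\ i) A j.
    by apply/bigcupP; exists j; rewrite // !inE ji.
  have -> : z \in \bigcup_(j in J2 :\ i) A j.
    by apply/bigcupP; exists j; rewrite // !inE ji.
  by rewrite !orbT.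
(* The violations give [rho U1 + rho U2 <= #|J1| + #|J2| - 2], while [h1] to [h6] and submodularity
   bound it below by [#|J1| + #|J2| - 1]. *)
have := rho_submod U1 U2; move/forallP: hA => hA.
have := hA (J1 :|: J2); rewrite subUset J1S J2S /= => h1.
have := hA ((J1 :&: J2) :\ i); rewrite (subset_trans (subD1set _ _)) ?subIset ?J1S //= => h2.
have h3 := rhoS cupJ; have h4 := rhoS capJ.
have h5 := cardsUI J1 J2.
have h6 : #|J1 :&: J2| = (1 + #|(J1 :&: J2) :\ i|)%N.
  by rewrite (cardsD1 i (J1 :&: J2)) inE iJ1 iJ2.
lia.
Qed.

Lemma rado (S : {set I}) (A : {ffun I -> {set E}}) : hall_rank S A ->
  exists B : {ffun I -> {set E}}, [/\ hall_rank S B,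
    forall i, B i \subset A i & forall i, (#|B i| <= 1)%N].
Proof.
have [m] := ubnP (\sum_i #|A i|); elim: m A => // m IH A lt hA.
have [/forallP h|/forallPn[i]] := boolP [forall i, #|A i| <= 1]%N.
  by exists A; split.
rewrite -ltnNge => /card_gt1P[x [y [xA yA xy]]].
have step z : z \in A i -> hall_rank S (shrink A i z) ->
    exists B : {ffun I -> {set E}}, [/\ hall_rank S B,
    forall i, B i \subset A i & forall i, (#|B i| <= 1)%N].
  move=> zA hz; have [|B [hB BA B1]] := IH _ _ hz.
    move: lt; rewrite (bigD1 i) //= (cardsD1 z (A i)) zA.
    rewrite [X in _ -> (X < _)%N](bigD1 i) //= ffunE eqxx.
    rewrite add1n addSn ltnS; apply: leq_trans; rewrite ltnS leq_add2l.
    by apply: leq_sum => j /negPf ji; rewrite ffunE ji.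
  exists B; split => // j; apply: (subset_trans (BA j)).
  by rewrite ffunE; case: eqP => // ->; apply: subD1set.
by have /orP[] := hall_rank_shrink hA xy xA yA; apply: step.
Qed.

End Rado.

(** * Rank, closures and the union of k copies of a matroid *)

Section Matroid.

Variables (n : nat) (M : {set {set 'I_n}}).
Hypothesis mM : is_matroid M.

(* This is the span of I only when I is independent. *)
Definition closure (I : {set 'I_n}) : {set 'I_n} :=
  [set x | (x \in I) || (I :|: [set x] \notin M)].

Definition rank (T : {set 'I_n}) : nat := \max_(I in M | I \subset T) #|I|.

Lemma card_le_rank (I T : {set 'I_n}) :
  I \in M -> I \subset T -> (#|I| <= rank T)%N.
Proof. by move=> IM IT; rewrite /rank (bigop.bigmax_sup I) ?IM. Qed.

(** A maximum independent [K] inside [T] is fixed, and [I] is augmented from [K] until the sizes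
    agree. *)
Lemma rank_extend (I T : {set 'I_n}) : I \in M -> I \subset T ->
  exists J : {set 'I_n}, [/\ J \in M, I \subset J, J \subset T & #|J| = rank T].
Proof.
case: mM => _ _ aug IM IT.
have [|K /andP[KM KT] rK] := @eq_bigmax_cond _ [pred I | I \in M & I \subset T] (fun I => #|I|).
  by apply/card_gt0P; exists I; rewrite inE IM.
have {}rK : rank T = #|K| by [].
have [m] := ubnP (rank T - #|I|); elim: m I IM IT => // m IH I IM IT lt.
have [leK|ltK] := leqP #|K| #|I|.
  exists I; split => //; apply/eqP; rewrite eqn_leq card_le_rank //=.
  by rewrite rK.
have [i /setDP[iK iI] iM] := aug _ _ IM KM ltK.
have [||J [JM IJ JT rJ]] := IH (I :|: [set i]) iM.
- by rewrite subUset IT sub1set (subsetP KT).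
- by rewrite setUC cardsU1 iI; lia.
by exists J; split => //; apply: subset_trans IJ; apply: subsetUl.
Qed.

Lemma set0_indep : set0 \in M. Proof. by case: mM. Qed.

Lemma rankS (A B : {set 'I_n}) : A \subset B -> (rank A <= rank B)%N.
Proof.
move=> AB; have [I [IM _ IA <-]] := rank_extend set0_indep (sub0set A).
by apply: card_le_rank => //; apply: subset_trans AB.
Qed.

(** A basis [I] of [A :&: B] extends to a basis [J] of [A :|: B]; the parts of [J] in [A] and in [B]
    are independent and share at least [I]. *)
Lemma rank_submod (A B : {set 'I_n}) :
  (rank (A :|: B) + rank (A :&: B) <= rank A + rank B)%N.
Proof.
case: (mM) => _ sub _.
have [I [IM _ IAB <-]] := rank_extend set0_indep (sub0set (A :&: B)).
have [|J [JM IJ JAB <-]] := @rank_extend I (A :|: B) IM.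
  by apply: subset_trans IAB _; rewrite subIset // subsetUl.
have hA : (#|J :&: A| <= rank A)%N.
  by apply: card_le_rank; [apply: sub JM _; apply: subsetIl | apply: subsetIr].
have hB : (#|J :&: B| <= rank B)%N.
  by apply: card_le_rank; [apply: sub JM _; apply: subsetIl | apply: subsetIr].
have := cardsUI (J :&: A) (J :&: B).
rewrite -setIUr setIACA setIid (setIidPl JAB).
have : (#|I| <= #|J :&: (A :&: B)|)%N by rewrite subset_leq_card // subsetI IJ.
lia.
Qed.

Lemma rank_indep (T : {set 'I_n}) : (#|T| <= rank T)%N -> T \in M.
Proof.
have [J [JM _ JT rJ]] := rank_extend set0_indep (sub0set T).
rewrite -rJ => le; suff <- : J = T by [].
by apply/eqP; rewrite eqEcard JT.
Qed.

Lemma rank_closure (T : {set 'I_n}) :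
  exists2 I, I \in M & T \subset closure I /\ #|I| = rank T.
Proof.
have [I [IM _ IT rI]] := rank_extend set0_indep (sub0set T).
exists I => //; split => //; apply/subsetP => x xT; rewrite inE.
have [//|xI] := boolP (x \in I); apply/negP => IxM.
have := @card_le_rank (I :|: [set x]) T IxM.
by rewrite subUset IT sub1set xT -rI setUC cardsU1 xI => /(_ isT); rewrite ltnn.
Qed.

(** Otherwise [I] could be augmented by an element of [closure I] outside [I], which the closure
    excludes. *)
Lemma indep_closure (P I : {set 'I_n}) :
  P \in M -> I \in M -> (#|P :&: closure I| <= #|I|)%N.
Proof.
case: mM => _ sub aug PM IM; rewrite leqNgt; apply/negP => lt.
have PI : P :&: closure I \in M by apply: sub PM _; apply: subsetIl.
have [i /setDP[]] := aug _ _ IM PI lt.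
by rewrite !inE => /andP[_ /orP[-> //|/negPf ->]].
Qed.

(** The rank condition of matroid union, tested only on flats, each given by a basis [I]. For
    [I = set0] it forbids loops in [S]. *)
Definition closure_bounded (k : nat) (S : {set 'I_n}) : bool :=
  [forall I in M, #|S :&: closure I| <= k * #|I|]%N.

(** The easy direction of matroid union, for a subset of the labels: each label class meets
    [closure I] in at most [#|I|] elements. *)
Lemma labelled_closure_bounded (k : nat) (S : {set 'I_n})
    (f : {ffun 'I_n -> 'I_k}) (L : {set 'I_k}) :
  (forall l, [set i in S | f i == l] \in M) ->
  closure_bounded #|L| [set i in S | f i \in L].
Proof.
move=> fM; apply/forall_inP => I IM.
have -> : [set i in S | f i \in L] :&: closure I =
    \bigcup_(l in L) ([set i in S | f i == l] :&: closure I).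
  apply/setP => x; apply/idP/bigcupP => [/setIP[]|[l lL /setIP[]]].
    by rewrite inE => /andP[xS xL] xI; exists (f x); rewrite // inE xI inE xS eqxx.
  by rewrite inE => /andP[xS /eqP xl] xI; rewrite inE xI inE xS xl lL.
apply: leq_trans (_ : \sum_(l in L) #|I| <= _)%N; last first.
  by rewrite sum_nat_const.
elim/big_rec2: _ => [|l a A _ h]; first by rewrite cards0.
apply: leq_trans (leq_card_setU _ _) _; apply: leq_add h.
exact: indep_closure.
Qed.

Definition slice (k : nat) (X : {set 'I_n * 'I_k}) (l : 'I_k) : {set 'I_n} :=
  [set i | (i, l) \in X].

(* Rado's theorem for the direct sum of k copies of M, with the lists
   A i = {i} x [k]: an independent transversal is a labelling of S. *)
Theorem matroid_union (k : nat) (S : {set 'I_n}) : (0 < k)%N ->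
  closure_bounded k S -> S \in kfold_union k M.
Proof.
case: k => // k _ /forall_inP cb.
pose rho (X : {set 'I_n * 'I_k.+1}) := (\sum_l rank (slice X l))%N.
have rho0 : rho set0 = 0%N.
  apply: big1 => l _; apply/eqP; rewrite -leqn0.
  apply/bigop.bigmax_leqP => I /andP[_]; have -> : slice set0 l = set0.
    by apply/setP => i; rewrite !inE.
  by rewrite subset0 => /eqP ->; rewrite cards0.
have rhoS (X Y : {set 'I_n * 'I_k.+1}) : X \subset Y -> (rho X <= rho Y)%N.
  move=> XY; apply: leq_sum => l _; apply: rankS.
  by apply/subsetP => i; rewrite !inE; apply: (subsetP XY).
have rho_sub (X Y : {set 'I_n * 'I_k.+1}) :
    (rho (X :|: Y) + rho (X :&: Y) <= rho X + rho Y)%N.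
  rewrite /rho -!big_split; apply: leq_sum => l _ /=.
  have -> : slice (X :|: Y) l = slice X l :|: slice Y l.
    by apply/setP => i; rewrite !inE.
  have -> : slice (X :&: Y) l = slice X l :&: slice Y l.
    by apply/setP => i; rewrite !inE.
  exact: rank_submod.
pose A := [ffun i : 'I_n => [set p : 'I_n * 'I_k.+1 | p.1 == i]].
have hA : hall_rank rho S A.
  apply/forallP => J; apply/implyP => JS.
  have [I IM [JI rI]] := rank_closure J.
  apply: leq_trans (_ : k.+1 * #|I| <= _)%N.
    apply: leq_trans (cb I IM); rewrite subset_leq_card // subsetI JS //.
  (* The union of the lists over [J] is [J] times all labels, so every slice equals [J]. *)
  rewrite /rho (eq_bigr (fun=> #|I|)) ?sum_nat_const ?card_ord // => l _.
  rewrite rI; congr rank; apply/setP => i; rewrite inE.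
  apply/bigcupP/idP => [[j jJ]|iJ]; first by rewrite ffunE inE /= => /eqP ->.
  by exists i; rewrite // ffunE inE.
have [B [/forallP hB BA B1]] := rado rho0 rhoS rho_sub hA.
rewrite inE; apply/existsP.
(* [B i] holds at most one pair, whose label is taken; [ord0] only serves an empty [B i]. *)
exists [ffun i => odflt ord0 [pick l | (i, l) \in B i]].
apply/forallP => l; set T := [set i in S | _]; apply: rank_indep.
have TS : T \subset S by apply/subsetP => i; rewrite inE => /andP[].
(* The lists over [T] live in copy [l] only, so [rho] of their union reduces to a single rank, at
   most [rank T]. *)
have := hB T; rewrite TS /= => /leq_trans; apply.
rewrite /rho (bigD1 l) //= [X in (_ + X)%N]big1 ?addn0.
  apply: rankS; apply/subsetP => i; rewrite inE => /bigcupP[j jT jB].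
  by move: (subsetP (BA j) _ jB); rewrite ffunE inE /= => /eqP ->.
move=> l' l'l; apply/eqP; rewrite -leqn0; apply/bigop.bigmax_leqP => I /andP[_ Isub].
suff /eqP -> : I == set0 by rewrite cards0.
rewrite -subset0; apply: subset_trans Isub _.
apply/subsetP => i; rewrite inE => /bigcupP[j jT jB]; exfalso.
move: (subsetP (BA j) _ jB); rewrite ffunE inE /= => /eqP ij.
move: jT jB; rewrite -{j}ij inE ffunE => /andP[_].
case: pickP => /= [l1 l1B /eqP l1l l'B|nB _ l'B]; last by rewrite nB in l'B.
move/negP: l'l; apply; rewrite -l1l.
by have /card_le1_eqP/(_ _ _ l'B l1B)[->] := B1 i.
Qed.

End Matroid.

(** * Means over random orders and random subsets *)

Section Averages.

Variables (R : realType) (n : nat).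
Implicit Types (A B S : {set 'I_n}) (F G : seq 'I_n -> R).
Implicit Types (g h : {set 'I_n} -> R) (w : 'I_n -> R).

Definition order_mean A F : R :=
  (#|A|`!%:R)^-1 * \sum_(s <- permutations (enum A)) F s.

Lemma perm_eq_set A s : perm_eq s (enum A) -> [set x in s] = A.
Proof. by move=> /perm_mem sA; apply/setP => x; rewrite inE sA mem_enum. Qed.

Lemma order_mean_set0 F : order_mean set0 F = F [::].
Proof.
rewrite /order_mean cards0 invr1 mul1r enum_set0.
by rewrite (_ : permutations _ = [:: [::]]) // big_seq1.
Qed.

(** The last element of a random order is uniform and the others form a random order of what
    remains; the inductions on orders below condition backwards in this way. *)
Lemma order_mean_rcons A F : (0 < #|A|)%N ->
  order_mean A F =
  #|A|%:R^-1 * \sum_(i in A) order_mean (A :\ i) (fun s => F (rcons s i)).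
Proof.
move=> A0; pose orders := [seq rcons s i | i <- enum A, s <- permutations (enum (A :\ i))].
have -> : order_mean A F = (#|A|`!%:R)^-1 * \sum_(s <- orders) F s.
  congr (_ * _); apply: perm_big; apply: uniq_perm.
  - exact: permutations_uniq.
  - apply: allpairs_uniq_dep => [|i _|[i s] [j t] _ _ /rcons_inj[-> ->] //].
      exact: enum_uniq.
    exact: permutations_uniq.
  move=> s; rewrite mem_permutations; apply/idP/allpairsPdep.
    case/lastP: s => [|s i] sA.
      by move: A0; rewrite cardE -(perm_size sA).
    have iA : i \in A by rewrite -mem_enum -(perm_mem sA) mem_rcons inE eqxx.
    exists i, s; split; rewrite ?mem_enum ?mem_permutations //.
    have := perm_uniq sA; rewrite enum_uniq rcons_uniq => /andP[is_ us].
    apply: uniq_perm => // [|x]; first exact: enum_uniq.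
    have := perm_mem sA x; rewrite !mem_enum mem_rcons !inE => <-.
    by case: eqP => // ->; apply/negbTE.
  move=> [i [s' []]]; rewrite mem_enum mem_permutations => iA s'A ->.
  have us' : uniq s' by rewrite (perm_uniq s'A) enum_uniq.
  apply: uniq_perm => [||x]; last 1 first.
  - rewrite mem_rcons inE (perm_mem s'A) !mem_enum !inE.
    by case: eqP => // ->; rewrite iA.
  - by rewrite rcons_uniq us' (perm_mem s'A) mem_enum !inE eqxx.
  exact: enum_uniq.
rewrite /orders big_allpairs_dep big_enum /= -(prednK A0) factS natrM invfM -mulrA.
rewrite (prednK A0) mulr_sumr; congr (_ * _); apply: eq_bigr => i iA.
by rewrite /order_mean (_ : #|A :\ i| = #|A|.-1) // (cardsD1 i A) iA.
Qed.

Lemma order_mean_perm F :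
  order_mean setT F =
  (n`!%:R)^-1 * \sum_(s : {perm 'I_n}) F [seq s t | t <- enum 'I_n].
Proof.
rewrite /order_mean cardsT card_ord; congr (_ * _).
rewrite -big_enum -(big_map (fun s : {perm 'I_n} => [seq s t | t <- enum 'I_n]) predT F).
apply: perm_big; apply: uniq_perm.
- exact: permutations_uniq.
- rewrite map_inj_uniq ?enum_uniq // => s t /eq_in_map st.
  by apply/permP => x; apply: st; rewrite mem_enum.
move=> s; rewrite mem_permutations; apply/idP/mapP.
  move=> sT; have us : uniq s by rewrite (perm_uniq sT) enum_uniq.
  have ss : size s = n by rewrite (perm_size sT) -cardE cardsT card_ord.
  (* The permutation sends a position to the element found there; as [size s = n], the default [t]
     is never returned. *)
  have inj : injective (fun t : 'I_n => nth t s t).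
    move=> t u; rewrite (set_nth_default u) ?ss // => /eqP.
    by rewrite nth_uniq ?ss // => /eqP /val_inj.
  exists (perm inj); first by rewrite mem_enum.
  rewrite (eq_map (fun t => permE inj t)).
  have sn : size (enum 'I_n) = size s by rewrite ss size_enum_ord.
  case: s {sT us inj} ss sn => [|x0 s'] ss sn; first by case: (enum _) sn.
  set s := x0 :: s' in ss sn *; apply: (@eq_from_nth _ x0) => [|i].
    by rewrite size_map.
  rewrite ss => im; rewrite (nth_map x0) ?size_enum_ord // nth_enum_ord //.
  by apply: set_nth_default; rewrite ss.
move=> [p _ ->]; apply: uniq_perm; rewrite ?enum_uniq //.
  by rewrite map_inj_uniq ?enum_uniq //; apply: perm_inj.
move=> x; rewrite mem_enum inE; apply/mapP; exists ((p^-1)%g x).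
  by rewrite mem_enum.
by rewrite permKV.
Qed.

Lemma ler_order_mean A F G :
  (forall s, [set x in s] = A -> F s <= G s) -> order_mean A F <= order_mean A G.
Proof.
move=> FG; rewrite ler_wpM2l ?invr_ge0 // big_seq [leRHS]big_seq.
by apply: ler_sum => s; rewrite mem_permutations => /perm_eq_set/FG.
Qed.

Lemma order_meanD A F G :
  order_mean A (fun s => F s + G s) = order_mean A F + order_mean A G.
Proof. by rewrite /order_mean big_split mulrDr. Qed.

Lemma order_meanZ A c F :
  order_mean A (fun s => c * F s) = c * order_mean A F.
Proof. by rewrite /order_mean -mulr_sumr mulrCA. Qed.

Lemma order_mean_cst A c : order_mean A (fun=> c) = c.
Proof.
rewrite /order_mean big_const_seq count_predT size_permutations ?enum_uniq //.
rewrite -cardE iter_addr_0 -[c *+ _]mulr_natl mulKf //.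
by rewrite pnatr_eq0 -lt0n fact_gt0.
Qed.

Lemma order_mean_sum (J : finType) (P : pred J) A (F : J -> seq 'I_n -> R) :
  order_mean A (fun s => \sum_(j | P j) F j s) = \sum_(j | P j) order_mean A (F j).
Proof. by rewrite /order_mean exchange_big mulr_sumr. Qed.

(* The mean of g over the sets left after removing j successive uniformly
   random elements from A. *)
Fixpoint thin (j : nat) g A : R :=
  if j is j'.+1 then #|A|%:R^-1 * \sum_(i in A) thin j' g (A :\ i) else g A.

Lemma ler_thin j A g h :
  (forall S, S \subset A -> #|S| = (#|A| - j)%N -> g S <= h S) ->
  thin j g A <= thin j h A.
Proof.
elim: j A => [|j IH] A gh /=; first by apply: gh; rewrite ?subn0.
rewrite ler_wpM2l ?invr_ge0 //; apply: ler_sum => i iA; apply: IH => S SA cS.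
apply: gh; first exact: subset_trans SA (subD1set _ _).
by rewrite cS (cardsD1 i A) iA add1n subSS.
Qed.

Lemma thinD j A g h : thin j (fun S => g S + h S) A = thin j g A + thin j h A.
Proof.
elim: j A => //= j IH A; rewrite -mulrDr -big_split; congr (_ * _).
by apply: eq_bigr => i _; rewrite IH.
Qed.

Lemma thinZ j A c g : thin j (fun S => c * g S) A = c * thin j g A.
Proof.
elim: j A => //= j IH A; rewrite [RHS]mulrCA; congr (_ * _); rewrite mulr_sumr.
by apply: eq_bigr => i _; rewrite IH.
Qed.

Lemma thin_sum (J : finType) (P : pred J) j A (g : J -> {set 'I_n} -> R) :
  thin j (fun S => \sum_(l | P l) g l S) A = \sum_(l | P l) thin j (g l) A.
Proof.
elim: j A => //= j IH A; rewrite -mulr_sumr exchange_big; congr (_ * _).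
by apply: eq_bigr => i _; rewrite IH.
Qed.

(** Each element of [A] survives the thinning with probability [t.+1 / #|A|]. Writing the final size
    as [t.+1] keeps the denominators nonzero. *)
Lemma thin_weight j t B A w : #|A| = (t.+1 + j)%N ->
  thin j (fun S => \sum_(i in B :&: S) w i) A =
  t.+1%:R / #|A|%:R * \sum_(i in B :&: A) w i.
Proof.
elim: j A => [|j IH] A cA /=.
  by rewrite cA addn0 divff ?mul1r // pnatr_eq0.
have cD i : i \in A -> #|A :\ i| = (t.+1 + j)%N.
  by move=> iA; move: cA; rewrite (cardsD1 i A) iA; lia.
have cj : (t.+1 + j)%:R != 0 :> R by rewrite pnatr_eq0; lia.
have cj1 : #|A|%:R = 1 + (t.+1 + j)%:R :> R by rewrite cA addnS -natr1 addrC.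
have drop i : i \in A ->
  \sum_(x in B :&: (A :\ i)) w x
    = \sum_(x in B :&: A) w x - (if i \in B then w i else 0).
  move=> iA; rewrite setIDA; case: ifPn => iB.
    by rewrite [in RHS](big_setD1 i) ?inE ?iA ?iB //= addrAC subrr add0r.
  rewrite subr0; apply: eq_bigl => x; rewrite !inE.
  by case: eqP => // ->; rewrite (negPf iB).
rewrite (eq_bigr (fun i => t.+1%:R / (t.+1 + j)%:R *
    (\sum_(x in B :&: A) w x - (if i \in B then w i else 0)))); last first.
  by move=> i iA; rewrite IH ?cD // drop.
rewrite -mulr_sumr sumrB sumr_const -big_mkcondr /=.
set W := \sum_(i in _) _.
have -> : \sum_(i in A | i \in B) w i = W.
  by apply: eq_bigl => i; rewrite inE andbC.
rewrite -[W *+ _]mulr_natl.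
have : #|A|%:R != 0 :> R by rewrite cA pnatr_eq0; lia.
rewrite cj1; move: (_%:R) cj => m m0 m1; field; exact/andP.
Qed.

Lemma bernoulli (z : R) c : 0 <= z <= 1 -> 1 - c%:R * z <= (1 - z) ^+ c.
Proof.
move=> /andP[z0 z1]; elim: c => [|c IH]; first by rewrite mul0r subr0 expr0.
rewrite exprS -natr1.
have : (1 - z) * (1 - c%:R * z) <= (1 - z) * (1 - z) ^+ c.
  by rewrite ler_wpM2l ?subr_ge0.
have : 0 <= c%:R * z * z by rewrite !mulr_ge0.
by move=> ? ?; lra.
Qed.

(* Sampling without replacement is dominated by independent sampling. *)
Lemma thin_mgf j t C A (a : R) : 0 <= a -> #|A| = (t.+1 + j)%N ->
  thin j (fun S => (1 + a) ^+ #|C :&: S|) A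
    <= (1 + a * (t.+1%:R / #|A|%:R)) ^+ #|C :&: A|.
Proof.
move=> a0; elim: j A => [|j IH] A cA /=.
  by rewrite cA addn0 divff ?mulr1 // pnatr_eq0.
have cD i : i \in A -> #|A :\ i| = (t.+1 + j)%N.
  by move=> iA; move: cA; rewrite (cardsD1 i A) iA; lia.
set m : R := (t.+1 + j)%:R.
have m0 : 0 < m by rewrite ltr0n; lia.
have mE : #|A|%:R = m + 1 by rewrite cA addnS -natr1.
set b := 1 + a * (t.+1%:R / m).
have b0 : 0 <= a * (t.+1%:R / m) by rewrite mulr_ge0 // divr_ge0 // ltW.
have b1 : 0 < b by rewrite /b; lra.
set c := #|C :&: A|.
have step i : i \in A ->
    thin j (fun S => (1 + a) ^+ #|C :&: S|) (A :\ i)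
    <= b ^+ c * (1 - (if i \in C then 1 - b^-1 else 0)).
  move=> iA; apply: le_trans (IH _ (cD _ iA)) _; rewrite cD // -/m -/b.
  rewrite setIDA; case: ifPn => iC.
    rewrite /c [X in b ^+ X * _](cardsD1 i) inE iC iA /= exprS.
    by rewrite opprB addrCA subrr addr0 mulrAC mulfV ?mul1r // gt_eqF.
  rewrite subr0 mulr1 [X in (_ ^+ X <= _)](_ : _ = c) ?lexx //.
  by apply: eq_card => x; rewrite !inE; case: eqP => // ->; rewrite (negPf iC).
apply: le_trans (_ : #|A|%:R^-1 * (\sum_(i in A) 
   (b ^+ c * (1 - (if i \in C then 1 - b^-1 else 0)))) <= _).
  by rewrite ler_wpM2l ?invr_ge0 //; apply: ler_sum.
rewrite -mulr_sumr sumrB sumr_const -big_mkcondr /=.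
rewrite [X in _ - X](eq_bigl (fun i => i \in C :&: A)); last first.
  by move=> i; rewrite inE andbC.
rewrite sumr_const -/c.
(* [b] is the base for size [#|A| - 1] and [b * (1 - z)] the one for [#|A|]. Removing an element of
   [C] divides by [b]; Bernoulli's inequality absorbs the average. *)
set z := (1 - b^-1) / (m + 1).
have -> : #|A|%:R^-1 * (b ^+ c * (1 *+ #|A| - (1 - b^-1) *+ c)) = b ^+ c * (1 - c%:R * z).
  rewrite mE -[(1 - b^-1) *+ c]mulr_natl /z.
  have m10 : m + 1 != 0 by rewrite gt_eqF //; lra.
  by clearbody m; move: (b ^+ c) (c%:R) (1 - b^-1) => u v y; field.
have -> : 1 + a * (t.+1%:R / #|A|%:R) = b * (1 - z).
  rewrite /z mE; have b' : b != 0 by rewrite gt_eqF.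
  have -> : b * (1 - (1 - b^-1) / (m + 1)) = b - (b - 1) / (m + 1) by field; rewrite b' /=; lra.
  by rewrite /b; field; rewrite !gt_eqF //; lra.
rewrite exprMn; apply: ler_wpM2l; first exact/exprn_ge0/ltW.
apply: bernoulli.
have binv : b^-1 <= 1 by rewrite invf_le1 // /b; lra.
have binv0 : 0 <= b^-1 by rewrite invr_ge0 ltW.
rewrite divr_ge0 ?subr_ge0 //=; last lra.
rewrite ler_pdivrMr; lra.
Qed.

(** Conditioning backwards, the set of the first [#|A| - j] arrivals has the law of [thin j], and
    [h] bounds from below the mean increment of [F] given that set. *)
Lemma order_mean_ge_thin (g : seq 'I_n -> 'I_n -> R) F h A :
  F [::] = 0 -> (forall s i, F (rcons s i) = F s + g s i) ->
  (forall S, (0 < #|S|)%N ->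
     h S <= #|S|%:R^-1 * \sum_(i in S) order_mean (S :\ i) (g^~ i)) ->
  \sum_(j < #|A|) thin j h A <= order_mean A F.
Proof.
move=> F0 Fr hg; have [m] := ubnP #|A|; elim: m A => // m IH A lt.
have [A0|A0] := posnP #|A|.
  rewrite A0 big_ord0; move/eqP: A0; rewrite cards_eq0 => /eqP ->.
  by rewrite order_mean_set0 F0.
rewrite order_mean_rcons // (eq_bigr (fun i => order_mean (A :\ i) F + order_mean (A :\ i) (g^~ i))).
  rewrite big_split mulrDr /= -(big_mkord xpredT (fun j => thin j h A)).
  rewrite -{1}(prednK A0) big_nat_recl // big_mkord addrC.
  apply: lerD; last exact: hg.
  rewrite -mulr_sumr exchange_big ler_wpM2l ?invr_ge0 //.
  apply: ler_sum => i iA; have cD : #|A :\ i| = #|A|.-1 by rewrite (cardsD1 i A) iA.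
  by rewrite -cD; apply: IH; rewrite cD prednK.
move=> i _; rewrite -order_meanD; congr (_ * _).
by apply: eq_bigr => s _; rewrite Fr.
Qed.

End Averages.

(** * Online algorithms that select by the current best set *)

Section SelectionAlgorithm.

Variables (R : realType) (n : nat) (F : {set {set 'I_n}}).
Variable sel : {set 'I_n} -> {ffun 'I_n -> R} -> {set 'I_n}.

Definition arrived (h : history n R) : {set 'I_n} :=
  [set j | has (fun e : 'I_n * R * bool => e.1.1 == j) h].

(** Elements not yet arrived get the default weight 0, as in [restrict], so the two agree on a
    truthful history. *)
Definition revealed (h : history n R) : {ffun 'I_n -> R} :=
  [ffun j => (nth (j, 0, false) h
                (find (fun e : 'I_n * R * bool => e.1.1 == j) h)).1.2].

Definition sel_alg : online_alg n R := fun h i x =>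
  let h' := rcons h (i, x, true) in
  ((i \in sel (arrived h') (revealed h')) && (accepted h :|: [set i] \in F))%:R.

Lemma sel_alg_valid : valid_alg F sel_alg.
Proof.
move=> h i x; rewrite /sel_alg; split=> [|/negPf ->]; last by rewrite andbF.
by rewrite ler0n lern1 leq_b1.
Qed.

Variable w : 'I_n -> R.
Hypothesis w0 : forall i, 0 <= w i.
Hypothesis Fdown : forall S T : {set 'I_n}, S \in F -> T \subset S -> T \in F.

Definition restrict (A : {set 'I_n}) : {ffun 'I_n -> R} :=
  [ffun j => if j \in A then w j else 0].

Definition chosen (A : {set 'I_n}) : {set 'I_n} := sel A (restrict A).

Fixpoint tentative_rev (r : seq 'I_n) : {set 'I_n} :=
  if r is i :: r' then
    (if i \in chosen [set x in r] then [set i] else set0) :|: tentative_rev r'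
  else set0.

(* The elements selected on arrival, accepted or not. *)
Definition tentative (s : seq 'I_n) : {set 'I_n} := tentative_rev (rev s).

(** Feasibility is tested against [tentative s], a superset of what is accepted; this lower bound on
    the real gain depends on the order alone. *)
Definition gain (s : seq 'I_n) (i : 'I_n) : R :=
  w i * ((i \in chosen [set x in rcons s i]) &&
         (tentative s :|: [set i] \in F))%:R.

Fixpoint total_gain_rev (r : seq 'I_n) : R :=
  if r is i :: r' then total_gain_rev r' + gain (rev r') i else 0.

Definition total_gain (s : seq 'I_n) : R := total_gain_rev (rev s).

Lemma set_rcons (s : seq 'I_n) i : [set x in rcons s i] = i |: [set x in s].
Proof. by apply/setP => x; rewrite !inE mem_rcons inE. Qed.

Lemma tentative_rcons s i : tentative (rcons s i) =
  (if i \in chosen [set x in rcons s i] then [set i] else set0) :|: tentative s.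
Proof.
have -> : [set x in rcons s i] = [set x in i :: rev s].
  by apply/setP => x; rewrite !inE mem_rcons !inE mem_rev.
by rewrite /tentative rev_rcons.
Qed.

Lemma total_gain_rcons s i : total_gain (rcons s i) = total_gain s + gain s i.
Proof. by rewrite /total_gain rev_rcons /= revK. Qed.

Lemma gain_ge0 s i : 0 <= gain s i.
Proof. by rewrite mulr_ge0. Qed.

Lemma arrived_revealed (h : history n R) :
  (forall e, e \in h -> e.1.2 = w e.1.1) ->
  arrived h = [set x in [seq e.1.1 | e <- h]] /\
  revealed h = restrict [set x in [seq e.1.1 | e <- h]].
Proof.
move=> hw.
have ah : arrived h = [set x in [seq e.1.1 | e <- h]].
  apply/setP => x; rewrite !inE; apply/hasP/mapP => -[e eh].
    by move/eqP <-; exists e.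
  by move=> ->; exists e.
split => //; rewrite -ah; apply/ffunP => j; rewrite !ffunE inE.
have [hj|/hasNfind ->] := boolP (has _ _); last by rewrite nth_default.
set e := nth _ _ _.
have /eqP ej : e.1.1 == j by apply: (nth_find (j, 0, false) hj).
by rewrite hw ?ej // mem_nth // -has_find.
Qed.

Lemma accepted_rcons (h : history n R) i x b :
  accepted (rcons h (i, x, b)) = (if b then [set i] else set0) :|: accepted h.
Proof.
apply/setP => j; rewrite !inE has_rcons /=.
by case: b; rewrite ?andbT ?andbF ?inE // eq_sym.
Qed.

(** Invariant: the accepted set lies in the tentative one. As [F] is downward closed, the algorithm
    can accept every element that [gain] counts. *)
Lemma exp_gain_ge rest s (h : history n R) :
  [seq e.1.1 | e <- h] = s -> (forall e, e \in h -> e.1.2 = w e.1.1) ->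
  accepted h \subset tentative s ->
  total_gain (s ++ rest) - total_gain s <= exp_gain sel_alg w h rest.
Proof.
elim: rest s h => [|i rest IH] s h hs hw acc /=; first by rewrite cats0 subrr.
have hw' b e : e \in rcons h (i, w i, b) -> e.1.2 = w e.1.1.
  by rewrite mem_rcons inE => /orP[/eqP -> //|/hw].
have hs' b : [seq e.1.1 | e <- rcons h (i, w i, b)] = rcons s i.
  by rewrite map_rcons hs.
rewrite -cat_rcons {1}/sel_alg {2}/sel_alg.
have [-> ->] := arrived_revealed (hw' true); rewrite hs' -/(chosen _).
have IHi b := IH (rcons s i) (rcons h (i, w i, b)) (hs' b) (hw' b).
have := total_gain_rcons s i; rewrite /gain.
have [ic /=|ic /=] := boolP (i \in chosen _); last first.
  have := IHi false; rewrite tentative_rcons (negPf ic) accepted_rcons !set0U.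
  by move=> /(_ acc) h1 h2; lra.
have [acF|acF] := boolP (accepted h :|: [set i] \in F); last first.
  have := IHi false; rewrite accepted_rcons set0U tentative_rcons ic.
  have /negPf -> : tentative s :|: [set i] \notin F.
    by apply: contra acF => tF; apply: Fdown tF _; apply: setSU.
  move=> /(_ (subset_trans acc (subsetUr _ _))) h1; rewrite -[false%:R]/(0 : R) => h2.
  by lra.
have := IHi true; rewrite accepted_rcons tentative_rcons ic.
rewrite -[true%:R]/(1 : R) => /(_ (setUS _ acc)) h1 h2.
have : w i * (tentative s :|: [set i] \in F)%:R <= w i.
  by rewrite ler_piMr //; case: (_ \in _); rewrite ?lexx ?ler01.
by move=> h3; lra.
Qed.

Lemma expected_value_ge :
  order_mean setT total_gain <= expected_value sel_alg w.
Proof.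
rewrite order_mean_perm /expected_value ler_wpM2l ?invr_ge0 //.
apply: ler_sum => s _; set o := map _ _.
have := @exp_gain_ge o [::] [::] erefl.
by rewrite /total_gain subr0; apply.
Qed.

(* Peel the order from its end: given the set of the first t arrivals, the last
   of them is uniform in that set, so it hits the selection inside T with
   probability at most p whatever happens later. *)
Lemma tentative_mgf (T A : {set 'I_n}) (a p : R) : 0 <= a -> 0 <= p ->
  (forall S : {set 'I_n}, S \subset A ->
     #|S :&: (chosen S :&: T)|%:R <= p * #|S|%:R) ->
  order_mean A (fun s => (1 + a) ^+ #|tentative s :&: T|) <= (1 + a * p) ^+ #|A|.
Proof.
move=> a0 p0; have [m] := ubnP #|A|; elim: m A => // m IH A lt chT.
have [A0|A0] := posnP #|A|.
  rewrite A0 expr0; move/eqP: A0; rewrite cards_eq0 => /eqP ->.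
  by rewrite order_mean_set0 /tentative set0I cards0 expr0.
rewrite order_mean_rcons //.
set q := (1 + a * p) ^+ #|A|.-1.
have q0 : 0 <= q by rewrite exprn_ge0 // addr_ge0 // mulr_ge0.
apply: le_trans (_ : #|A|%:R^-1 * (\sum_(i in A)
    (1 + (if i \in chosen A :&: T then a else 0)) * q) <= _).
  rewrite ler_wpM2l ?invr_ge0 //; apply: ler_sum => i iA.
  have cD : #|A :\ i| = #|A|.-1 by rewrite (cardsD1 i A) iA.
  apply: le_trans (_ : order_mean (A :\ i) (fun s =>
    (1 + (if i \in chosen A :&: T then a else 0)) *
    (1 + a) ^+ #|tentative s :&: T|) <= _).
    apply: ler_order_mean => s sA; rewrite tentative_rcons set_rcons sA setD1K //.
    rewrite setIUl inE; case: (i \in chosen A) => /=; last first.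
      by rewrite set0I set0U addr0 mul1r.
    have [iT|iT] := boolP (i \in T).
      rewrite -exprS ler_weXn2l ?lerDl //.
      apply: leq_trans (leq_card_setU _ _) _; rewrite -add1n leq_add2r.
      by rewrite -(cards1 i) subset_leq_card // subsetIl.
    rewrite (_ : [set i] :&: T = set0) ?set0U ?addr0 ?mul1r //.
    by apply/setP => x; rewrite !inE; case: eqP => // ->; apply/negbTE.
  rewrite order_meanZ; apply: ler_wpM2l.
    by rewrite addr_ge0 //; case: ifP.
  rewrite /q -cD; apply: IH; first by rewrite cD prednK.
  by move=> S SA; apply: chT; apply: subset_trans SA (subD1set _ _).
rewrite -mulr_suml big_split /= sumr_const -big_mkcondr /=.
rewrite [X in _ + X](eq_bigl (fun i => i \in A :&: (chosen A :&: T))); last first.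
  by move=> i; rewrite !inE.
rewrite sumr_const -(prednK A0) exprS (prednK A0) -/q mulrA ler_wpM2r //.
rewrite mulrC ler_pdivrMr ?ltr0n // mulrDl mul1r lerD2l -mulr_natr -!mulrA.
by rewrite mul1r -[leLHS]mulr_natr ler_wpM2l // chT.
Qed.

(** Given the set [S] of arrivals, the last one is uniform in [S] and is counted when chosen and
    feasible, over a random order of the rest. *)
Lemma order_mean_gain (d : R) (S : {set 'I_n}) : chosen S \subset S ->
  (forall i, i \in chosen S -> 1 - d <=
     order_mean (S :\ i) (fun s => (tentative s :|: [set i] \in F)%:R)) ->
  (1 - d) / #|S|%:R * \sum_(i in chosen S) w i <=
  #|S|%:R^-1 * \sum_(i in S) order_mean (S :\ i) (gain^~ i).
Proof.
move=> cS feas; rewrite mulrAC mulrC ler_wpM2l ?invr_ge0 //.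
rewrite [leRHS](big_setID (chosen S)) /= (setIidPr cS) -[leLHS]addr0.
apply: lerD; last first.
  apply: sumr_ge0 => i _; rewrite -(order_mean_cst (S :\ i) 0).
  by apply: ler_order_mean => s _; apply: gain_ge0.
rewrite mulr_sumr; apply: ler_sum => i ic; rewrite mulrC.
apply: le_trans (ler_wpM2l (w0 i) (feas i ic)) _; rewrite -order_meanZ.
apply: ler_order_mean => s sS; rewrite /gain set_rcons sS setD1K ?ic //.
exact: subsetP ic.
Qed.

End SelectionAlgorithm.

(** * Concentration *)

Section Tails.

Variable R : realType.

Lemma sum_expr_card (n : nat) (r : R) :
  \sum_(I : {set 'I_n}) r ^+ #|I| = (1 + r) ^+ n.
Proof.
have := bigA_distr 1 +%R (fun _ : 'I_n => r) (fun=> 1).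
rewrite prodr_const card_ord addrC => ->.
by apply: eq_bigr => I _; rewrite -big_mkcond prodr_const.
Qed.

(** The sum is [(1 + r) ^+ n] without the term 1 of [set0]; the induction is a converse Bernoulli
    inequality for small [r]. *)
Lemma sum_expr_card_le (n : nat) (r : R) : 0 <= r -> 2 * n%:R * r <= 1 ->
  \sum_(I : {set 'I_n} | I != set0) r ^+ #|I| <= 2 * n%:R * r.
Proof.
move=> r0 nr; suff : (1 + r) ^+ n <= 1 + 2 * n%:R * r.
  by rewrite -sum_expr_card (bigD1 set0) //= cards0 expr0 lerD2l.
elim: n nr => [|n IH]; first by rewrite expr0 mulr0 mul0r addr0.
rewrite -natr1 => nr; have {}IH := IH ltac:(lra).
rewrite exprS; apply: le_trans (_ : (1 + r) * (1 + 2 * n%:R * r) <= _).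
  by rewrite ler_wpM2l //; lra.
have : r * (2 * n%:R * r) <= r * 1 by rewrite ler_wpM2l //; lra.
lra.
Qed.

(** From [1 + x <= expR x] at [x = a ^+ 2 - a], since [(1 + a) * (1 - a + a ^+ 2) = 1 + a ^+ 3]. *)
Lemma expR_le_1D (a : R) : 0 <= a -> expR (a - a ^+ 2) <= 1 + a.
Proof.
move=> a0; rewrite -(ler_pM2r (expR_gt0 (a ^+ 2 - a))) -expRD.
rewrite (_ : a - a ^+ 2 + (a ^+ 2 - a) = 0) ?expR0; last by ring.
have : (1 + a) * (1 + (a ^+ 2 - a)) <= (1 + a) * expR (a ^+ 2 - a).
  by rewrite ler_wpM2l ?expR_ge1Dx //; lra.
have : 0 <= a * (a * a) by rewrite !mulr_ge0.
by lra.
Qed.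

(** Tail at threshold [N] for mean [m], with moment parameter [a = e / 2]: the exponent is [a * (1 -
    e) - (a - a ^+ 2) = - (e ^+ 2 / 4)]. *)
Lemma chernoff (e m : R) (N : nat) : 0 <= e -> m <= (1 - e) * N%:R ->
  expR (e / 2 * m) / (1 + e / 2) ^+ N <= expR (- (e ^+ 2 / 4)) ^+ N.
Proof.
move=> e0 mN; have a0 : 0 <= e / 2 by lra.
rewrite ler_pdivrMr ?exprn_gt0 //; last lra.
apply: le_trans (_ : expR (e / 2 * (1 - e)) ^+ N <= _).
  rewrite -expRM_natl ler_expR -mulr_natl.
  have := ler_wpM2l a0 mN; lra.
rewrite -exprMn lerXn2r ?nnegrE ?expR_ge0 ?mulr_ge0 ?expR_ge0 //; first lra.
apply: le_trans (ler_wpM2l (expR_ge0 _) (expR_le_1D a0)).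
by rewrite -expRD ler_expR; lra.
Qed.

Lemma expr_1D_le_expR (x : R) (c : nat) : 0 <= x -> (1 + x) ^+ c <= expR (x * c%:R).
Proof.
move=> x0; rewrite expRM_natr lerXn2r ?nnegrE ?expR_ge0 ?expR_ge1Dx //; lra.
Qed.

End Tails.

(** * Keeping the heaviest parts of a set in the k-fold union *)

Section Scaling.

Variables (R : realType) (n : nat) (M : {set {set 'I_n}}).
Hypothesis mM : is_matroid M.

(** Labels are dropped one by one; the lightest remaining one weighs at most the average, so the
    average never decreases. *)
Lemma heavy_labels (k j : nat) (W : 'I_k -> R) : (j <= k)%N ->
  exists L : {set 'I_k}, #|L| = j /\
    j%:R * (\sum_l W l) <= k%:R * \sum_(l in L) W l.
Proof.
move=> jk; have [d] := ubnP (k - j)%N; elim: d j jk => // d IH j jk lt.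
have [->|jk'] := eqVneq j k.
  exists setT; rewrite cardsT card_ord; split => //.
  by rewrite [leRHS](_ : _ = k%:R * \sum_l W l) //; congr (_ * _); apply: eq_bigl => l; rewrite inE.
have [||L [cL hL]] := IH j.+1; [lia | lia |].
have [l0 l0L] : exists l, l \in L by apply/card_gt0P; rewrite cL.
case: (@Order.TotalTheory.arg_minP _ _ _ l0 (mem L) W l0L) => l; rewrite /= => lL lmin.
have {}lL : l \in L by [].
exists (L :\ l); split; first by move: cL; rewrite (cardsD1 l) lL => -[].
have := big_setD1 l lL : \sum_(i in L) W i = _; set WL := \sum_(i in L :\ l) _ => eL.
have : j.+1%:R * W l <= \sum_(i in L) W i.
  by rewrite -cL mulr_natl -sumr_const; apply: ler_sum => i /lmin.
move: hL; rewrite eL /= -!natr1 => h1 h2.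
have j1 : 0 < j%:R + 1 :> R by rewrite ltr_pwDr.
rewrite -(ler_pM2l j1) mulrCA.
have h3 : j%:R * ((j%:R + 1) * \sum_l0 W l0) <= j%:R * (k%:R * (W l + WL)).
  by rewrite ler_wpM2l.
apply: le_trans h3 _.
have : k%:R * ((j%:R + 1) * W l) <= k%:R * (W l + WL) by rewrite ler_wpM2l.
have : 0 <= k%:R :> R by [].
lra.
Qed.

(** The [j] heaviest of the [k] parts of [S] retain a share [j / k] of its weight. This supplies
    competitors for smaller capacities. *)
Lemma kfold_union_scale (k j : nat) (S : {set 'I_n}) (w : 'I_n -> R) :
  (j <= k)%N -> S \in kfold_union k M ->
  exists B : {set 'I_n}, [/\ B \subset S, closure_bounded M j B &
    j%:R * (\sum_(i in S) w i) <= k%:R * \sum_(i in B) w i].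
Proof.
move=> jk; rewrite inE => /existsP[f /forallP fM].
have [L [cL hL]] := heavy_labels (fun l => \sum_(i in S | f i == l) w i) jk.
exists [set i in S | f i \in L]; split.
- by apply/subsetP => i; rewrite inE => /andP[].
- by rewrite -cL; apply: labelled_closure_bounded.
have -> : \sum_(i in S) w i = \sum_l \sum_(i in S | f i == l) w i.
  exact: (partition_big f xpredT).
suff -> : \sum_(i in [set i in S | f i \in L]) w i =
  \sum_(l in L) \sum_(i in S | f i == l) w i by [].
rewrite (partition_big f (mem L)) => [|i]; last by rewrite inE => /andP[].
apply: eq_bigr => l; rewrite /= => lL; apply: eq_bigl => i; rewrite inE.
by case: eqP => [->|]; rewrite ?andbF // !andbT [l \in L]lL andbT.
Qed.

End Scaling.

(** * Feasibility and sampling bounds for the best-set algorithm *)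

Section Concentration.

Variables (R : realType) (n : nat) (M : {set {set 'I_n}}) (kk : nat -> nat).
Hypothesis mM : is_matroid M.

(* Feasibility is phrased with closure_bounded because kfold_union 0 M is empty
   for n > 0: it does not even contain set0. *)
Definition best (A : {set 'I_n}) (v : {ffun 'I_n -> R}) : {set 'I_n} :=
  [arg max_(S > set0 | (S \subset A) && closure_bounded M (kk #|A|) S)
     \sum_(i in S) v i]%O.

Variable w : 'I_n -> R.
Hypothesis w0 : forall i, 0 <= w i.
Local Notation picked := (chosen best w).
Local Notation pending := (tentative best w).

Lemma bestP (A : {set 'I_n}) :
  [/\ picked A \subset A, closure_bounded M (kk #|A|) (picked A) &
   forall S : {set 'I_n}, S \subset A -> closure_bounded M (kk #|A|) S ->
     \sum_(i in S) w i <= \sum_(i in picked A) w i].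
Proof.
have sumE (S : {set 'I_n}) : S \subset A ->
    \sum_(i in S) restrict w A i = \sum_(i in S) w i.
  by move=> SA; apply: eq_bigr => i iS; rewrite ffunE (subsetP SA).
rewrite /chosen /best; case: Order.TotalTheory.arg_maxP => [|S /andP[SA cS] Smax].
  rewrite sub0set; apply/forall_inP => I _.
  by rewrite set0I cards0.
split => // T TA cT; rewrite -!sumE //; apply: Smax; exact/andP.
Qed.

Lemma chosen_sub A : picked A \subset A. Proof. by case: (bestP A). Qed.

Lemma chosen_closure A I : I \in M ->
  (#|picked A :&: closure M I| <= kk #|A| * #|I|)%N.
Proof. by move=> IM; case: (bestP A) => _ /forall_inP /(_ I IM). Qed.

(** [closure M set0] consists of the loops. Its constraint holds surely, so the union bound can be
    restricted to nonempty [I]. *)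
Lemma chosen_noloop A i : i \in picked A -> i \notin closure M set0.
Proof.
move=> iA; apply/negP => il; have := chosen_closure A (set0_indep mM).
by rewrite cards0 muln0 leqNgt card_gt0 => /negP[]; apply/set0Pn; exists i; rewrite inE iA.
Qed.

Lemma tentative_noloop s i : i \in pending s -> i \notin closure M set0.
Proof.
elim/last_ind: s => [|s j IH]; first by rewrite inE.
rewrite tentative_rcons inE => /orP[|//].
case: ifP => [/chosen_noloop h /set1P -> //|_]; by rewrite in_set0.
Qed.

(** If [I] is tight or violated, its own term is at least 1, so the sum dominates the failure
    indicator. Tightness counts because the arriving element may still be added. *)
Lemma union_bound (k : nat) (S : {set 'I_n}) (a : R) (I : {set 'I_n}) :
  0 <= a -> I \in M -> I != set0 -> (k * #|I| <= #|S :&: closure M I|)%N ->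
  1 <= \sum_(J in M | J != set0)
         (1 + a) ^+ #|S :&: closure M J| / (1 + a) ^+ (k * #|J|).
Proof.
move=> a0 IM I0 kI; have a1 : 0 < 1 + a by lra.
rewrite (bigD1 I) /=; last by rewrite IM.
apply: le_trans (_ : (1 + a) ^+ #|S :&: closure M I| / (1 + a) ^+ (k * #|I|) <= _).
  by rewrite ler_pdivlMr ?exprn_gt0 // mul1r ler_weXn2l ?lerDl.
by rewrite lerDl sumr_ge0 // => J _; rewrite divr_ge0 // exprn_ge0 // ltW.
Qed.

Lemma feasible_mean (k : nat) (e : R) (S : {set 'I_n}) (i : 'I_n) :
  (0 < k)%N -> 0 <= e <= 1 ->
  (forall t, (kk t * n)%:R <= (1 - e) * (k * t)%:R) -> i \in picked S ->
  1 - \sum_(I : {set 'I_n} | I != set0) expR (- (e ^+ 2 / 4) * k%:R) ^+ #|I| <=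
  order_mean (S :\ i) (fun s => (pending s :|: [set i] \in kfold_union k M)%:R).
Proof.
move=> k0 /andP[e0 e1] kkt iS; have a0 : 0 <= e / 2 by lra.
have n0 : (0 < n)%N by case: (n) i {iS} => // -[].
have n0R : 0 < n%:R :> R by rewrite ltr0n.
pose bound s : R := \sum_(I in M | I != set0)
  (1 + e / 2) ^+ #|pending s :&: closure M I| / (1 + e / 2) ^+ (k * #|I|).
apply: le_trans (_ : order_mean (S :\ i) (fun s => 1 + -1 * bound s) <= _); last first.
  apply: ler_order_mean => s _; case: (boolP (_ \in _)) => infeas.
    rewrite mulN1r gerDl oppr_le0 sumr_ge0 // => J _.
    by rewrite divr_ge0 // exprn_ge0 //; lra.
  rewrite mulN1r subr_le0.
  have /forall_inPn[I IM] : ~~ closure_bounded M k (pending s :|: [set i]).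
    by apply: contra infeas; apply: matroid_union.
  rewrite -ltnNge => lt; apply: (union_bound (I := I)) => //.
    apply: contraTneq lt => ->; rewrite cards0 muln0 -leqNgt leqn0 cards_eq0.
    rewrite -subset0; apply/subsetP => j; rewrite !inE => /andP[/orP[jt|/eqP ->]].
      by have := tentative_noloop jt; rewrite !inE => /negPf ->.
    by have := chosen_noloop iS; rewrite !inE => /negPf ->.
  rewrite -ltnS; apply: leq_trans lt _; rewrite setIUl.
  apply: leq_trans (leq_card_setU _ _) _; rewrite -addn1 leq_add2l.
  by rewrite -(cards1 i) subset_leq_card // subsetIl.
rewrite order_meanD order_mean_cst order_meanZ mulN1r lerD2l lerN2 order_mean_sum.
apply: le_trans (_ : \sum_(I in M | I != set0)
  expR (- (e ^+ 2 / 4) * k%:R) ^+ #|I| <= _); last first.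
  rewrite [leRHS](bigID (mem M)) /= -[leLHS]addr0 lerD //.
    by rewrite (eq_bigl (fun I => (I != set0) && (I \in M))) // => I; rewrite andbC.
  by apply: sumr_ge0 => I _; rewrite exprn_ge0 // expR_ge0.
apply: ler_sum => I /andP[IM I0].
rewrite (_ : order_mean _ _ = order_mean (S :\ i) (fun s =>
  ((1 + e / 2) ^+ (k * #|I|))^-1 * (1 + e / 2) ^+ #|pending s :&: closure M I|)); last first.
  by rewrite /order_mean; congr (_ * _); apply: eq_bigr => s _; rewrite mulrC.
rewrite order_meanZ.
set p : R := (1 - e) * (k * #|I|)%:R / n%:R.
have p0 : 0 <= p by rewrite divr_ge0 // mulr_ge0 // subr_ge0.
apply: le_trans (_ : ((1 + e / 2) ^+ (k * #|I|))^-1 * (1 + e / 2 * p) ^+ #|S :\ i| <= _).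
  rewrite ler_wpM2l ?invr_ge0 ?exprn_ge0 //; first lra.
  apply: tentative_mgf => // T _; rewrite /p mulrAC ler_pdivlMr // -natrM.
  apply: le_trans (_ : (kk #|T| * #|I| * n)%:R <= _).
    rewrite ler_nat leq_mul2r; apply/orP; right.
    by apply: leq_trans (chosen_closure T IM); rewrite subset_leq_card // subsetIr.
  rewrite mulnAC natrM; apply: le_trans (ler_wpM2r _ (kkt #|T|)) _ => //.
  by rewrite -!mulrA -!natrM mulnAC.
rewrite mulrC.
apply: le_trans (_ : expR (e / 2 * (p * n%:R)) / (1 + e / 2) ^+ (k * #|I|) <= _).
  rewrite ler_wpM2r ?invr_ge0 ?exprn_ge0 //; first lra.
  have ap0 : 0 <= e / 2 * p by rewrite mulr_ge0.
  apply: le_trans (expr_1D_le_expR _ ap0) _; rewrite ler_expR mulrA ler_wpM2l // ler_nat.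
  by apply: leq_trans (max_card _) _; rewrite card_ord.
apply: le_trans (chernoff e0 _) _; first by rewrite /p mulfVK ?gt_eqF.
by rewrite exprM expRM_natr.
Qed.

Lemma tentative_indep_large (k : nat) (s : seq 'I_n) (i : 'I_n) (S : {set 'I_n}) :
  (0 < k)%N -> (n <= k)%N -> i \in picked S ->
  pending s :|: [set i] \in kfold_union k M.
Proof.
move=> k0 nk iS; apply: matroid_union => //; apply/forall_inP => I IM.
have [->|I0] := eqVneq I set0; last first.
  apply: leq_trans (max_card _) _; rewrite card_ord; apply: leq_trans nk _.
  by rewrite leq_pmulr // card_gt0.
rewrite cards0 muln0 leqn0 cards_eq0 -subset0; apply/subsetP => j.
rewrite in_setI in_setU in_set1 => /andP[/orP[/tentative_noloop/negPf -> //|/eqP ->]].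
by rewrite (negPf (chosen_noloop iS)).
Qed.

(** [B :&: S] competes for the best set inside a random [S] of size [t.+1]. On average it carries
    the share [t.+1 / n] of the weight of [B]; when it exceeds capacity [kk t.+1], the whole weight
    of [B] is written off. *)
Lemma sample_best_ge (t j b : nat) (e : R) (B : {set 'I_n}) :
  n = (t.+1 + j)%N -> 0 <= e -> closure_bounded M b B ->
  (b * t.+1)%:R <= (1 - e) * (kk t.+1 * n)%:R ->
  (t.+1%:R / n%:R - \sum_(I : {set 'I_n} | I != set0)
      expR (- (e ^+ 2 / 4) * (kk t.+1)%:R) ^+ #|I|) * (\sum_(i in B) w i)
  <= thin j (fun S => \sum_(i in picked S) w i) setT.
Proof.
move=> nE e0 /forall_inP cB bt; set W := \sum_(i in B) w i.
have W0 : 0 <= W by apply: sumr_ge0.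
have n0R : 0 < n%:R :> R by rewrite ltr0n nE.
have cT : #|[set: 'I_n]| = (t.+1 + j)%N by rewrite cardsT card_ord.
have a0 : 0 <= e / 2 by lra.
pose c (I : {set 'I_n}) : R := ((1 + e / 2) ^+ (kk t.+1 * #|I|))^-1.
have c0 I : 0 <= c I by rewrite invr_ge0 exprn_ge0 //; lra.
apply: le_trans (_ : thin j (fun S => \sum_(i in B :&: S) w i + - W *
   \sum_(I in M | I != set0) c I * (1 + e / 2) ^+ #|B :&: closure M I :&: S|) setT <= _); last first.
  apply: ler_thin => S _; rewrite cT addnK => cS.
  have sum0 : 0 <= \sum_(I in M | I != set0) c I * (1 + e / 2) ^+ #|B :&: closure M I :&: S|.
    by apply: sumr_ge0 => I _; rewrite mulr_ge0 // exprn_ge0 //; lra.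
  have [cb|/forall_inPn[I IM]] := boolP (closure_bounded M (kk t.+1) (B :&: S)).
    case: (bestP S) => _ _ /(_ (B :&: S)); rewrite subsetIr cS => /(_ isT cb).
    by apply: le_trans; rewrite mulNr gerDl oppr_le0 mulr_ge0.
  rewrite -ltnNge => lt; apply: le_trans (_ : 0 <= _); last by apply: sumr_ge0.
  have WS : \sum_(i in B :&: S) w i <= W.
    by rewrite /W [leRHS](big_setID S) /= lerDl sumr_ge0.
  have I0 : I != set0.
    apply: contraTneq lt => ->; rewrite cards0 muln0 -leqNgt.
    have := cB _ (set0_indep mM); rewrite cards0 muln0; apply: leq_trans.
    by rewrite subset_leq_card // setSI // subsetIl.
  have := union_bound a0 IM I0 (ltnW lt).
  rewrite (eq_bigr (fun J => c J * (1 + e / 2) ^+ #|B :&: closure M J :&: S|)); last first.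
    by move=> J _; rewrite mulrC setIAC.
  by move=> /(ler_wpM2l W0); rewrite mulr1 mulNr; lra.
rewrite thinD thinZ thin_sum (thin_weight _ _ cT) setIT -/W.
rewrite mulrBl [- W * _]mulNr cT -nE lerD2l lerN2 mulrC ler_wpM2r //.
apply: le_trans (_ : \sum_(I in M | I != set0)
  expR (- (e ^+ 2 / 4) * (kk t.+1)%:R) ^+ #|I| <= _); last first.
  rewrite [leRHS](bigID (mem M)) /= -[leLHS]addr0 lerD //.
    by rewrite (eq_bigl (fun I => (I != set0) && (I \in M))) // => I; rewrite andbC.
  by apply: sumr_ge0 => I _; rewrite exprn_ge0 // expR_ge0.
apply: ler_sum => I /andP[IM I0]; rewrite thinZ.
apply: le_trans (ler_wpM2l (c0 I) (thin_mgf _ a0 cT)) _.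
rewrite setIT cT -nE /c mulrC.
set q : R := t.+1%:R / n%:R.
have q0 : 0 <= q by rewrite divr_ge0.
have aq0 : 0 <= e / 2 * q by rewrite mulr_ge0.
apply: le_trans (_ : expR (e / 2 * (q * #|B :&: closure M I|%:R)) /
   (1 + e / 2) ^+ (kk t.+1 * #|I|) <= _).
  rewrite ler_wpM2r ?invr_ge0 ?exprn_ge0 //; first lra.
  by apply: le_trans (expr_1D_le_expR _ aq0) _; rewrite mulrA.
apply: le_trans (chernoff e0 _) _; last by rewrite exprM expRM_natr.
rewrite /q mulrAC ler_pdivrMr // -natrM.
apply: le_trans (_ : (b * t.+1)%:R * #|I|%:R <= _).
  by rewrite -natrM ler_nat mulnC mulnAC leq_mul2r cB ?orbT.
apply: le_trans (ler_wpM2r _ bt) _ => //.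
by rewrite -!mulrA -!natrM mulnAC.
Qed.

Lemma kfold_union_sub (k : nat) (S T : {set 'I_n}) :
  S \in kfold_union k M -> T \subset S -> T \in kfold_union k M.
Proof.
case: mM => _ sub _; rewrite !inE => /existsP[f /forallP fM] TS.
apply/existsP; exists f; apply/forallP => l; apply: sub (fM l) _.
by apply/subsetP => i; rewrite !inE => /andP[/(subsetP TS) -> ->].
Qed.

(** Index [j] counts from the end, so [n - j] elements have arrived; [d] bounds the probability that
    a chosen arrival does not fit. *)
Lemma sel_alg_value (k : nat) (d : R) :
  (forall S i, i \in picked S -> 1 - d <= order_mean (S :\ i)
     (fun s => (pending s :|: [set i] \in kfold_union k M)%:R)) ->
  \sum_(j < n) (1 - d) / (n - j)%:R *
     thin j (fun S => \sum_(i in picked S) w i) setT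
  <= expected_value (sel_alg (kfold_union k M) best) w.
Proof.
move=> feas; apply: le_trans (expected_value_ge _ w0 (@kfold_union_sub k)).
have cT : #|[set: 'I_n]| = n by rewrite cardsT card_ord.
pose H (S : {set 'I_n}) : R := (1 - d) / #|S|%:R * \sum_(i in picked S) w i.
apply: le_trans (_ : \sum_(j < #|[set: 'I_n]|) thin j H setT <= _).
  rewrite cT; apply: ler_sum => j _; rewrite -thinZ.
  by apply: ler_thin => S _; rewrite cT /H => ->.
apply: (@order_mean_ge_thin _ _ (gain (kfold_union k M) best w)) => //.
  by move=> s i; rewrite total_gain_rcons.
move=> S S0; apply: order_mean_gain => //; first exact: chosen_sub.
by move=> i iS; apply: feas.
Qed.

End Concentration.

(** * The competitive ratio *)

Section Competitive.

Variable R : realType.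

(** The step [1 / u <= 2 * (u - v)], where [u ^+ 2 = v ^+ 2 + 1], amounts to [0 <= (u - v) ^+ 2]. *)
Lemma sum_inv_sqrt (m : nat) :
  \sum_(i < m) (Num.sqrt i.+1%:R)^-1 <= 2 * Num.sqrt m%:R :> R.
Proof.
elim: m => [|m IH]; first by rewrite big_ord0 sqrtr0 mulr0.
rewrite big_ord_recr /=; apply: le_trans (lerD IH (lexx _)) _.
set u : R := Num.sqrt m.+1%:R; set v : R := Num.sqrt m%:R.
have u0 : 0 < u by rewrite sqrtr_gt0 ltr0n.
have u2 : u * u = 1 + m%:R by rewrite -expr2 sqr_sqrtr // -natr1 addrC.
have v2 : v * v = m%:R by rewrite -expr2 sqr_sqrtr.
rewrite -(ler_pM2r u0) mulrDl mulVf ?gt_eqF //.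
have : 0 <= (u - v) ^+ 2 by rewrite sqr_ge0.
rewrite expr2; lra.
Qed.

Lemma le_opt_bound (n : nat) (F : {set {set 'I_n}}) (w : 'I_n -> R) (c V : R) :
  0 <= V -> (forall S, S \in F -> c * \sum_(i in S) w i <= V) ->
  c * opt F w <= V.
Proof.
move=> V0 cV; rewrite /opt; elim/big_ind: _ => [|x y|S]; last exact: cV.
  by rewrite mulr0.
by move=> hx hy; rewrite /Num.max; case: ifP.
Qed.

Lemma expected_value0 (n : nat) (w : 'I_n -> R) :
  expected_value (fun _ _ _ => 0) w = 0.
Proof.
rewrite /expected_value big1 ?mulr0 // => s _.
elim: (map _ _) [::] => //= i r IH h.
by rewrite !IH !mul0r mulr0 addr0.
Qed.

Lemma opt_ge0 (n : nat) (F : {set {set 'I_n}}) (w : 'I_n -> R) : 0 <= opt F w.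
Proof.
rewrite /opt; elim/big_rec: _ => // S x _ x0; by rewrite le_max x0 orbT.
Qed.

Lemma thin_ge0 (n j : nat) (g : {set 'I_n} -> R) A :
  (forall S, 0 <= g S) -> 0 <= thin j g A.
Proof.
move=> g0; elim: j A => //= j IH A.
by rewrite mulr_ge0 ?invr_ge0 // sumr_ge0.
Qed.

(** For [n <= k] only loops are infeasible, so capacity [k] is used at all times and nothing is
    lost. *)
Lemma competitive_large (n k : nat) (M : {set {set 'I_n}}) (w : 'I_n -> R) :
  is_matroid M -> (0 < k)%N -> (n <= k)%N -> (forall i, 0 <= w i) ->
  opt (kfold_union k M) w <=
  expected_value (sel_alg (kfold_union k M) (best M (fun=> k))) w.
Proof.
move=> mM k0 nk w0; set V := expected_value _ _.
have val : \sum_(j < n) (1 - 0) / (n - j)%:R *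
     thin j (fun S => \sum_(i in chosen (best M (fun=> k)) w S) w i) setT <= V.
  apply: sel_alg_value => // S i iS; rewrite subr0 -[leLHS](order_mean_cst (S :\ i)).
  by apply: ler_order_mean => s _; rewrite (tentative_indep_large mM _ k0 nk iS).
have pos j : 0 <= thin j (fun S => \sum_(i in chosen (best M (fun=> k)) w S) w i) setT.
  by apply: thin_ge0 => S; apply: sumr_ge0.
rewrite -[opt _ _]mul1r; apply: le_opt_bound => [|S SF].
  by apply: le_trans val; apply: sumr_ge0 => j _; rewrite subr0 mulr_ge0 ?pos // div1r invr_ge0.
apply: le_trans val.
rewrite (_ : 1 * _ = \sum_(j < n) (n%:R^-1 * \sum_(i in S) w i)); last first.
  rewrite sumr_const card_ord -[_ *+ n]mulr_natl mul1r.
  case: n M w mM nk w0 V pos S SF => [|n] *; last by rewrite mulVKf // pnatr_eq0.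
  by rewrite mul0r big1 // => -[].
apply: ler_sum => j _; have jn := ltn_ord j.
rewrite subr0 -mulrA mul1r ler_pdivlMl ?ltr0n ?subn_gt0 //.
have [B [BS cB hB]] := kfold_union_scale mM w (leqnn k) SF.
have nE : #|[set: 'I_n]| = ((n - j).-1.+1 + j)%N.
  by rewrite cardsT card_ord prednK ?subn_gt0 // subnK // ltnW.
have kR : 0 < k%:R :> R by rewrite ltr0n.
apply: le_trans (_ : thin j (fun T => \sum_(i in B :&: T) w i) setT <= _).
  rewrite (thin_weight _ _ nE) cardsT card_ord prednK ?subn_gt0 // setIT -mulrA.
  by rewrite ler_wpM2l // ler_wpM2l ?invr_ge0 // -(ler_pM2l kR).
apply: ler_thin => T _ _; case: (bestP (R := R) M (fun=> k) w T) => _ _; apply.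
  exact: subsetIr.
apply/forall_inP => I IM; have /forall_inP/(_ I IM) := cB; apply: leq_trans.
by rewrite subset_leq_card // setSI // subsetIl.
Qed.

Lemma ln_nat_ge_half (n : nat) : (2 <= n)%N -> 1 / 2 <= ln n%:R :> R.
Proof.
move=> n2; rewrite -ler_expR lnK ?posrE ?ltr0n; last by lia.
apply: le_trans (_ : 2 <= _); last by rewrite (ler_nat _ 2).
have := expR_ge1Dx (- (1 / 2) : R); rewrite expRN => h.
have e0 := expR_gt0 (1 / 2 : R).
have := ler_wpM2r (ltW e0) h; rewrite mulVf ?gt_eqF //; lra.
Qed.

(* The failure probability of the union bound once the Chernoff exponent is
   at least 4 ln n. *)
Lemma union_bound_small (n : nat) (u : R) : (2 <= n)%N -> 4 * ln n%:R <= u ->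
  \sum_(I : {set 'I_n} | I != set0) expR (- u) ^+ #|I| <= (n%:R ^+ 2)^-1.
Proof.
move=> n2 hu; have n2R : 2 <= n%:R :> R by rewrite (ler_nat _ 2).
have n0 : 0 < n%:R :> R by lra.
have r4 : expR (- u) <= (n%:R ^+ 4)^-1.
  apply: le_trans (_ : expR (- (4 * ln n%:R)) <= _); first by rewrite ler_expR lerN2.
  by rewrite expRN expRM_natl lnK.
have r0 := expR_ge0 (- u).
have i0 : 0 < n%:R^-1 :> R by rewrite invr_gt0.
have i2 : n%:R^-1 <= 1 / 2 :> R by rewrite -div1r ler_pdivrMr //; lra.
have h : 2 * n%:R * expR (- u) <= (n%:R ^+ 2)^-1.
  apply: le_trans (ler_wpM2l _ r4) _; first by lra.
  have -> : 2 * n%:R * (n%:R ^+ 4)^-1 = (n%:R ^+ 2)^-1 * (2 / n%:R) :> R.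
    by field; lra.
  by rewrite ler_piMr ?invr_ge0 ?exprn_ge0 ?ler_pdivrMr //; lra.
apply: le_trans (h); apply: sum_expr_card_le => //; apply: le_trans h _.
by rewrite invf_le1 ?exprn_gt0 // exprn_ege1 //; lra.
Qed.

(** [d1] is the feasibility loss, [d2] the relative sampling loss and [r] the share of the optimum
    kept. *)
Lemma loss_arith (y d1 d2 r : R) : 0 <= y -> y <= 1 / 20 ->
  0 <= d1 -> d1 <= y / 10 -> 0 <= d2 -> d2 <= y / 10 -> 1 - 13 * y <= r ->
  1 - 20 * y <= (1 - d1) * ((1 - d2) * r).
Proof.
move=> y0 y1 d10 d11 d20 d21 yr.
have r0 : 0 <= 1 - 13 * y by lra.
have h1 : (1 - d2) * (1 - 13 * y) <= (1 - d2) * r by rewrite ler_wpM2l //; lra.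
have h2 : (1 - d1) * ((1 - d2) * (1 - 13 * y)) <= (1 - d1) * ((1 - d2) * r).
  by rewrite ler_wpM2l //; lra.
apply: le_trans h2.
have h3 : (1 - y / 10) * (1 - 13 * y) <= (1 - d2) * (1 - 13 * y).
  by rewrite ler_wpM2r //; lra.
have h4 : (1 - d1) * ((1 - y / 10) * (1 - 13 * y)) <=
    (1 - d1) * ((1 - d2) * (1 - 13 * y)) by rewrite ler_wpM2l //; lra.
apply: le_trans h4.
have h5 : (1 - y / 10) * ((1 - y / 10) * (1 - 13 * y)) <=
    (1 - d1) * ((1 - y / 10) * (1 - 13 * y)).
  by rewrite ler_wpM2r ?mulr_ge0 //; lra.
apply: le_trans h5; nra.
Qed.

(* z = k t / n is the expected capacity at time t, K the scaled integer
   capacity and b the number of parts of the optimum that fit into it. *)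
Lemma capacity_arith (x y z k K b L : R) : 0 <= x -> x <= y -> y <= 1 / 20 ->
  1 / 2 <= L -> 0 < z -> z <= k -> y ^+ 2 = L / z ->
  (1 - 4 * x) * z - 1 <= K -> (1 - 8 * y) * K * (k / z) - 1 <= b ->
  [/\ 4 * L <= (8 * y) ^+ 2 / 4 * K, 1 / z <= y / 10 &
     1 - 13 * y <= b / k].
Proof.
move=> x0 xy y1 L0 z0 zk y2 hK hb.
have k0 : 0 < k by lra.
have y2z : y ^+ 2 * z = L by rewrite y2 mulfVK ?gt_eqF.
have iz : 1 / z <= y / 10.
  rewrite ler_pdivrMr //; have : y * (y * z) <= 1 / 20 * (y * z).
    by rewrite ler_wpM2r // mulr_ge0; lra.
  by move: y2z; rewrite expr2; lra.
have hz : 0 < 1 / z by rewrite divr_gt0.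
have ziz : z * (1 / z) = 1 by rewrite mulrC mulfVK ?gt_eqF.
(* From [y ^+ 2 * z = L >= 1 / 2] and [y <= 1 / 20]; the rounding of [K] then still leaves
   [z / 4]. *)
have z200 : 200 <= z.
  have : 1 / z * z <= y / 10 * z by rewrite ler_wpM2r // ltW.
  have : y * y * z <= 1 / 20 * (1 / 20) * z.
    by rewrite ler_wpM2r ?(ltW z0) // ler_pM //; lra.
  by move: y2z; rewrite expr2; lra.
have Kz : z / 4 <= K.
  have : 4 * x * z <= 4 * (1 / 20) * z by rewrite ler_wpM2r ?(ltW z0) //; lra.
  lra.
split => //.
  have : y ^+ 2 * (z / 4) <= y ^+ 2 * K by rewrite ler_wpM2l ?sqr_ge0.
  by rewrite exprMn; lra.
(* The losses are [8 * y], [4 * x <= 4 * y] and, once for each rounding, at most [1 / z <= y / 10];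
   together at most [13 * y]. *)
have h1 : (1 - 4 * x) - 1 / z <= K / z.
  rewrite ler_pdivlMr //; lra.
have h2 : (1 - 8 * y) * ((1 - 4 * x) - 1 / z) <= (1 - 8 * y) * (K / z).
  by rewrite ler_wpM2l //; lra.
have h3 : 1 / k <= 1 / z by rewrite ler_pdivlMr // mulrAC ler_pdivrMr //; lra.
have h4 : (1 - 8 * y) * (K / z) - 1 / k <= b / k.
  rewrite ler_pdivlMr // mulrBl mulfVK ?gt_eqF //; apply: le_trans hb.
  by rewrite le_eqVlt; apply/orP; left; apply/eqP; field; rewrite gt_eqF.
have h5 : 0 <= 8 * y * (4 * x + 1 / z) by rewrite mulr_ge0 //; lra.
lra.
Qed.

(** For [x ^+ 2 = ln n / k], the slack [e = 4 * x] makes the Chernoff exponent [e ^+ 2 / 4 * k]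
    equal to [4 * ln n]. *)
Definition capacity (n k : nat) (x : R) (t : nat) : nat :=
  Num.truncn ((1 - 4 * x) * k%:R * t%:R / n%:R).

Lemma competitive_small (n k : nat) (M : {set {set 'I_n}}) (w : 'I_n -> R) :
  let x := Num.sqrt (ln n%:R / k%:R) in
  is_matroid M -> (0 < k)%N -> (k < n)%N -> (2 <= n)%N -> 40 * x < 1 ->
  (forall i, 0 <= w i) ->
  (1 - 40 * x) * opt (kfold_union k M) w <=
  expected_value (sel_alg (kfold_union k M) (best M (capacity n k x))) w.
Proof.
move=> x mM k0 kn n2 x1 w0; set V := expected_value _ _.
set kk := capacity n k x in V *.
pose L : R := ln n%:R.
have L0 : 1 / 2 <= L := ln_nat_ge_half n2.
have kR : 0 < k%:R :> R by rewrite ltr0n.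
have nR : 0 < n%:R :> R by rewrite ltr0n; lia.
have x0 : 0 <= x by apply: sqrtr_ge0.
have L1 : 0 <= L by lra.
have x2 : x ^+ 2 = L / k%:R by rewrite sqr_sqrtr // divr_ge0.
clearbody x.
set d : R := (n%:R ^+ 2)^-1.
have d0 : 0 <= d by rewrite invr_ge0 exprn_ge0.
have dn : d * n%:R = n%:R^-1 by rewrite /d; field; rewrite gt_eqF.
have n2R : 2 <= n%:R :> R by rewrite (ler_nat _ 2).
have dn1 : d <= n%:R^-1 by rewrite -dn ler_peMr //; lra.
have cap0 t : 0 <= (1 - 4 * x) * k%:R * t%:R / n%:R.
  by rewrite divr_ge0 // !mulr_ge0 //; lra.
have cap_le t : (kk t)%:R <= (1 - 4 * x) * k%:R * t%:R / n%:R by rewrite truncn_le.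
have val : \sum_(j < n) (1 - d) / (n - j)%:R *
     thin j (fun S => \sum_(i in chosen (best M kk) w S) w i) setT <= V.
  apply: sel_alg_value => // S i iS.
  apply: le_trans (feasible_mean mM (k := k) (e := 4 * x) _ _ _ iS) => //.
  - rewrite lerD2l lerN2 mulNr; apply: union_bound_small => //.
    have -> : (4 * x) ^+ 2 / 4 * k%:R = 4 * (x ^+ 2 * k%:R) by field.
    by rewrite x2 mulfVK ?gt_eqF.
  - by lra.
  by move=> t; have := cap_le t; rewrite ler_pdivlMr // !natrM mulrA.
have pos j : 0 <= thin j (fun S => \sum_(i in chosen (best M kk) w S) w i) setT.
  by apply: thin_ge0 => S; apply: sumr_ge0.
have n1 : n%:R^-1 <= 1 :> R by rewrite invf_le1 //; lra.
have d1 : 0 <= 1 - d by lra.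
apply: le_opt_bound => [|S SF].
  by apply: le_trans val; apply: sumr_ge0 => j _; rewrite mulr_ge0 // divr_ge0.
set W := \sum_(i in S) w i; have W0 : 0 <= W by apply: sumr_ge0.
apply: le_trans val.
(* This is the square root of [ln n] over the expected capacity [k * (n - j) / n]. Its sum over [j]
   is at most [2 * n * x], so the factor 20 becomes 40. *)
pose loss (j : nat) : R := x * (Num.sqrt n%:R / Num.sqrt (n - j)%:R).
apply: le_trans (_ : \sum_(j < n) (n%:R^-1 * (1 - 20 * loss j) * W) <= _).
  rewrite -mulr_suml ler_wpM2r // -mulr_sumr sumrB sumr_const card_ord.
  rewrite -mulr_sumr -mulr_sumr -mulr_sumr.
  have := sum_inv_sqrt n; rewrite (reindex_inj rev_ord_inj) /=.
  rewrite (eq_bigr (fun j : 'I_n => (Num.sqrt (n - j)%:R)^-1 : R)); last first.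
    by move=> j _; rewrite subnSK.
  set Sg := \sum_(i < n) _ => hS.
  rewrite [leRHS]mulrC ler_pdivlMr //.
  have sn : Num.sqrt n%:R * Num.sqrt n%:R = n%:R :> R by rewrite -expr2 sqr_sqrtr.
  have h1 : Num.sqrt n%:R * Sg <= 2 * n%:R.
    apply: le_trans (ler_wpM2l (sqrtr_ge0 _) hS) _; rewrite mulrCA sn //.
  have := ler_wpM2l x0 h1; lra.
apply: ler_sum => j _; have jn := ltn_ord j.
set t := (n - j)%N; have t0 : (0 < t)%N by rewrite subn_gt0.
have tR : 0 < t%:R :> R by rewrite ltr0n.
set y := loss j.
have y0 : 0 <= y by rewrite !mulr_ge0 // ?invr_ge0 ?sqrtr_ge0.
(* Early times, with [y > 1 / 20], only have a nonpositive bound to meet. *)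
have [y1|y1] := leP y (1 / 20); last first.
  apply: le_trans (_ : 0 <= _); last by rewrite mulr_ge0 // divr_ge0.
  by rewrite mulr_le0_ge0 // mulr_ge0_le0 ?invr_ge0 //; lra.
have tn : t%:R <= n%:R :> R by rewrite ler_nat leq_subr.
have xy : x <= y.
  by rewrite /y /loss ler_peMr // ler_pdivlMr ?sqrtr_gt0 // mul1r ler_wsqrtr.
pose z : R := k%:R * t%:R / n%:R.
have z0 : 0 < z by rewrite !mulr_gt0 // invr_gt0.
have zk : z <= k%:R by rewrite ler_pdivrMr // ler_wpM2l // ltW.
have y2 : y ^+ 2 = L / z.
  rewrite /y /loss !exprMn exprVn !sqr_sqrtr // x2 /z -/t.
  by field; rewrite !gt_eqF.
(* The number of parts of the optimum whose expected share in a sample of size [t] fits capacity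
   [kk t] with slack [8 * y]. *)
pose b := Num.truncn ((1 - 8 * y) * (kk t)%:R * (k%:R / z)).
have bE0 : 0 <= (1 - 8 * y) * (kk t)%:R * (k%:R / z).
  by rewrite mulr_ge0 ?divr_ge0 ?mulr_ge0 ?invr_ge0 ?(ltW z0) //; lra.
have b_le : b%:R <= (1 - 8 * y) * (kk t)%:R * (k%:R / z) by rewrite truncn_le.
have b_ge : (1 - 8 * y) * (kk t)%:R * (k%:R / z) - 1 <= b%:R.
  by rewrite lerBlDr natr1 ltW // truncnS_gt.
have kk_ge : (1 - 4 * x) * z - 1 <= (kk t)%:R.
  rewrite lerBlDr natr1 ltW // /z !mulrA; exact: truncnS_gt.
have [rate iz bk] := capacity_arith x0 xy y1 L0 z0 zk y2 kk_ge b_ge.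
have kz : k%:R / z = n%:R / t%:R by rewrite /z; field; rewrite !gt_eqF.
have bt : (b * t)%:R <= (1 - 8 * y) * (kk t * n)%:R.
  move: b_le; rewrite kz mulrA ler_pdivlMr // -natrM => h; apply: le_trans h _.
  by rewrite natrM mulrA.
have bk' : (b <= k)%N.
  rewrite -(ler_nat R); apply: le_trans b_le _.
  have : (kk t)%:R * (k%:R / z) <= k%:R.
    rewrite mulrA ler_pdivrMr // mulrC ler_wpM2l ?(ltW kR) //.
    apply: le_trans (cap_le t) _; rewrite -!mulrA [X in _ * X]mulrA -/z.
    by rewrite ler_piMl ?(ltW z0) //; lra.
  apply: le_trans; rewrite -mulrA ler_piMl ?mulr_ge0 ?divr_ge0 ?invr_ge0 ?(ltW z0) //; lra.
have [B [BS cB hB]] := kfold_union_scale mM w bk' SF; rewrite -/W in hB.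
set WB := \sum_(i in B) w i in hB.
have tE : t = t.-1.+1 by rewrite prednK.
have nE : n = (t.-1.+1 + j)%N by rewrite -tE subnK // ltnW.
have e0 : 0 <= 8 * y by lra.
have := sample_best_ge (kk := kk) mM w0 nE e0 cB; rewrite -tE => /(_ bt).
set T := thin _ _ _; set Sg := \sum_(I : {set 'I_n} | _) _ => hT.
have Sd : Sg <= d.
  by rewrite /Sg mulNr; apply: union_bound_small.
have WB0 : 0 <= WB by apply: sumr_ge0.
have {}hT : (t%:R / n%:R - d) * WB <= T.
  by apply: le_trans hT; rewrite ler_wpM2r // lerB.
have t1 : 1 <= t%:R :> R by rewrite ler1n.
have nz : n%:R^-1 <= 1 / z.
  rewrite -[n%:R^-1]div1r ler_pdivlMr // mulrAC ler_pdivrMr //.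
  rewrite mul1r (le_trans zk) // mul1r ler_nat ltnW //.
have dnt : d * n%:R / t%:R <= y / 10.
  by rewrite dn; apply: le_trans iz; apply: le_trans nz; rewrite ler_piMr ?invr_ge0 // invf_le1.
have dy : d <= y / 10 by lra.
have dnt0 : 0 <= d * n%:R / t%:R by rewrite !mulr_ge0 // invr_ge0.
have final := loss_arith y0 y1 d0 dy dnt0 dnt bk.
have hB' : b%:R / k%:R * W <= WB by rewrite mulrAC ler_pdivrMr // [leRHS]mulrC.
have q0 : 0 <= t%:R / n%:R - d.
  have -> : t%:R / n%:R - d = t%:R / n%:R * (1 - d * n%:R / t%:R).
    by field; rewrite !gt_eqF.
  by rewrite mulr_ge0 ?divr_ge0 //; lra.
apply: le_trans (_ : (1 - d) / t%:R * ((t%:R / n%:R - d) * (b%:R / k%:R * W)) <= _).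
  have -> : (1 - d) / t%:R * ((t%:R / n%:R - d) * (b%:R / k%:R * W)) =
    n%:R^-1 * ((1 - d) * ((1 - d * n%:R / t%:R) * (b%:R / k%:R))) * W.
    by field; rewrite !gt_eqF.
  by rewrite ler_wpM2r // ler_wpM2l // invr_ge0.
rewrite ler_wpM2l ?divr_ge0 //; apply: le_trans hT.
by rewrite ler_wpM2l.
Qed.

End Competitive.

Theorem theorem1 (R : realType) :
  exists c : R, 0 < c /\
  forall (n : nat) (M : {set {set 'I_n}}), is_matroid M ->
  forall k : nat, (0 < k)%N ->
  exists alg : online_alg n R,
    valid_alg (kfold_union k M) alg /\
    forall w : 'I_n -> R, injective w -> (forall i, 0 <= w i) ->
      (1 - c * Num.sqrt (ln (n%:R) / k%:R)) * opt (kfold_union k M) w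
        <= expected_value alg w.
Proof.
exists 40; split; first by [].
move=> n M mM k k0; set x := Num.sqrt _.
have x0 : 0 <= x by apply: sqrtr_ge0.
(* For [n <= k] the algorithm reaches [opt]; for [40 * x >= 1] the guarantee is nonpositive and
   rejecting everything suffices. *)
have [nk|kn] := leqP n k.
  exists (sel_alg (kfold_union k M) (best M (fun=> k))).
  split=> [|w _ w0]; first exact: sel_alg_valid.
  apply: le_trans (competitive_large mM k0 nk w0).
  by rewrite ler_piMl ?opt_ge0 // gerBl mulr_ge0.
have n2 : (2 <= n)%N by apply: leq_trans kn.
have [x1|x1] := ltP (40 * x) 1; last first.
  exists (fun _ _ _ => 0); split=> [h i y|w _ _]; first by rewrite lexx ler01.
  by rewrite expected_value0 mulr_le0_ge0 ?opt_ge0 // subr_le0.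
exists (sel_alg (kfold_union k M) (best M (capacity n k x))).
split=> [|w _ w0]; first exact: sel_alg_valid.
exact: competitive_small.
Qed.
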